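(* Let $p>1$ and let $F\in C^0([0,\infty))$ be any strictly convex function with $\lim_{s\to\infty}F(s)=\infty$. Then there exists a function $\beta\in C^0([0,\infty))$, increasing, with $\beta(0)\ge0$ and $\lim_{t\to\infty}\beta(t)=\infty$, such that the function $g$ associated with $\beta$ by $$g(\tau)=e^{\gamma(\Psi^{-1}(\tau))/(p-1)}-1,\quad \tau\in[0,\infty),\qquad \gamma(t)=\int_0^t\beta(\theta)\,d\theta,\qquad \Psi(t)=\int_0^te^{\gamma(\theta)/(p-1)}d\theta,$$ satisfies $$\limsup_{\tau\to\infty}\frac{g(\tau)}{F(\tau)}=\infty .$$
   Context: Here $\Psi:[0,\infty)\to[0,\infty)$ is an increasing bijection, so $g$ is well defined on $[0,\infty)$. *)

(* Defs.v *)
From HB Require Import structures.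
From mathcomp Require Import all_boot all_order all_algebra.
From mathcomp Require Import all_classical all_reals all_analysis.

Set Implicit Arguments.
Unset Strict Implicit.
Unset Printing Implicit Defensive.

Import Order.TTheory GRing.Theory Num.Theory.
Import numFieldNormedType.Exports.

Local Open Scope classical_set_scope.
Local Open Scope ring_scope.

(* Functions on [0, oo) are represented by total functions R -> R whose values
   at negative arguments are irrelevant. *)

(* The library's [convex_function] is the non-strict notion. *)
Definition strictly_convex_on (R : realType) (A : set R) (f : R -> R) : Prop :=
  forall x y t : R, A x -> A y -> x != y -> 0 < t < 1 ->
    f (t * x + (1 - t) * y) < t * f x + (1 - t) * f y.

Definition gamma (R : realType) (beta : R -> R) (t : R) : R :=
  \int[lebesgue_measure]_(theta in `[0, t]) beta theta.

Definition Psi (R : realType) (p : R) (beta : R -> R) (t : R) : R :=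
  \int[lebesgue_measure]_(theta in `[0, t])
    expR (gamma beta theta / (p - 1)).

(* Inverse of [Psi p beta] as a map from [0, oo) to [0, oo).  If beta is
   continuous and nonnegative on [0, oo) and p > 1, the integrand of Psi is
   continuous and at least 1, so Psi is a bijection of [0, oo) and the default
   value 0 of the partial inverse is never used at nonnegative arguments. *)
Definition Psi_inv (R : realType) (p : R) (beta : R -> R) : R -> R :=
  'pinv_(fun=> 0) `[0, +oo[ (Psi p beta).

Definition g_of (R : realType) (p : R) (beta : R -> R) (tau : R) : R :=
  expR (gamma beta (Psi_inv p beta tau) / (p - 1)) - 1.

(* Main.v *)
Require Import Defs.
From HB Require Import structures.
From mathcomp Require Import all_boot all_order all_algebra.
From mathcomp Require Import all_classical all_reals all_analysis.
From mathcomp Require Import lra.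

Import Order.TTheory GRing.Theory Num.Theory.
Import numFieldNormedType.Exports.

Local Open Scope classical_set_scope.
Local Open Scope ring_scope.

(** The identity [g (Psi t) = Psi' t - 1] lets everything be read off at points
    [tau = Psi t], so that [Psi_inv] only enters through injectivity of [Psi].
    It is then enough to find times [t_n] tending to infinity with
    [n * F (Psi t_n) <= Psi' t_n - 1], where [Psi' = exp (gamma / (p - 1))].

    What makes this possible against an arbitrary [F] is that a steep jump of
    [beta] of height [M] over a very short time [d] changes [Psi'] without
    changing [Psi] much.  If the product [M * d] is kept at a prescribed value
    [c], then after time [2 * d] the primitive [gamma] is at least [c], however
    small [d] is, while [gamma] also stays below a bound that does not depend on
    [d]; hence [Psi] has grown by at most [2 * d] times a fixed constant, which
    is at most [1] for small [d] ([gamma_Psi_after_jump]).  So one first bounds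
    [Psi n] by some [Phi] from the values of [beta] before time [n], then picks
    [c] so that [exp (c / (p - 1)) - 1] is [n] times a bound of [F] on
    [0, Phi + 1], and finally picks [d] ([exists_jump]).  Convexity bounds [F] on
    such an interval by its values at the two ends
    ([strictly_convex_le_ends]).

    The jump at time [n] depends on [beta] before [n] only through the total
    height of the earlier jumps, so heights and widths are given by a plain
    recursion on real numbers ([exists_jumps]).  The function [beta] is the sum
    of the identity, which makes it strictly increasing and unbounded, and of
    one ramp per integer ([staircase]). *)

(** * Primitives of nondecreasing functions *)

Lemma nondecreasing_integrable (R : realType) (h : R -> R) (a b : R) :
  {homo h : x y / x <= y} ->
  lebesgue_measure.-integrable `[a, b] (EFin \o h).
Proof.
move=> hh; apply: measurable_bounded_integrable => //.
- rewrite /= lebesgue_measure_itv/=; case: ifP => _; rewrite ?ltry// -EFinB ltry.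
- exact: measurable_realfun.nondecreasing_measurable.
exists (`|h a| + `|h b|); split; first exact: num_real.
move=> M hM x /=; rewrite in_itv/= => /andP[ax xb].
apply/ltW/(le_lt_trans _ hM); have := hh _ _ ax; have := hh _ _ xb.
move=> h1 h2; rewrite ler_norml; apply/andP; split.
  by have := ler_norm (- h a); rewrite normrN; have := normr_ge0 (h b); lra.
by have := ler_norm (h b); have := normr_ge0 (h a); lra.
Qed.

(** Every estimate on [gamma] and on [Psi] below is an instance of this one:
    both are primitives of nondecreasing functions, so comparison with the
    values at the ends of an interval replaces differentiation. *)
Lemma nondecreasing_integral_increment (R : realType) (h : R -> R) (a b : R) :
  {homo h : x y / x <= y} -> 0 <= a -> a <= b ->
  h a * (b - a) <=
    \int[lebesgue_measure]_(x in `[0, b]) h x -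
    \int[lebesgue_measure]_(x in `[0, a]) h x <= h b * (b - a).
Proof.
move=> hh a0 ab.
have ih := @nondecreasing_integrable R h 0 b hh.
rewrite (Rintegral_itvB ih) ?bnd_simp//.
have mu_ab : fine (lebesgue_measure `]a, b]) = b - a.
  rewrite lebesgue_measure_itv/= lte_fin; case: ltP => // ba.
  by have -> : a = b; [lra | rewrite subrr].
have ih' : lebesgue_measure.-integrable `]a, b] (EFin \o h).
  apply: integrableS ih => // x /=; rewrite !in_itv/= => /andP[ax ->].
  by rewrite andbT; lra.
have ic c : lebesgue_measure.-integrable `]a, b] (EFin \o cst c).
  have icc := nondecreasing_integrable R (cst c) a b (fun _ _ _ => lexx c).
  apply: integrableS icc => // x /=; rewrite !in_itv/= => /andP[/ltW -> ->].
  by [].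
rewrite -mu_ab -!Rintegral_cst//; apply/andP; split; apply: le_Rintegral => //.
- exact: ic.
- by move=> x /=; rewrite in_itv/= => /andP[/ltW ax _]; exact: hh.
- exact: ic.
- by move=> x /=; rewrite in_itv/= => /andP[_ ax]; exact: hh.
Qed.

(** * The functions gamma and Psi of a nondecreasing beta *)

Section Primitives.
Context {R : realType}.
Variables (p : R) (beta : R -> R).
Hypotheses (hp : 1 < p) (hbeta : {homo beta : x y / x <= y}).
Hypothesis (beta0 : 0 <= beta 0).

Lemma gamma0 (t : R) : t <= 0 -> gamma beta t = 0.
Proof.
rewrite /gamma le_eqVlt => /predU1P[->|t0].
  by rewrite set_itv1 Rintegral_set1.
by rewrite set_itv_ge ?Rintegral_set0// bnd_simp -ltNge.
Qed.

(** Monotone on the whole line and not just on the nonnegative half-line, where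
    [beta] is nonnegative: before [0] the domain of integration is empty. This
    makes the integrand of [Psi] a nondecreasing function of a real variable. *)
Lemma gamma_nondecreasing : {homo gamma beta : x y / x <= y}.
Proof.
have mono x y : 0 <= x -> x <= y -> gamma beta x <= gamma beta y.
  move=> x0 xy; have /andP[+ _] := nondecreasing_integral_increment _ _ _ _ hbeta x0 xy.
  rewrite -/(gamma beta x) -/(gamma beta y).
  have : 0 <= beta x * (y - x).
    by rewrite mulr_ge0 ?subr_ge0// (le_trans beta0)// hbeta.
  lra.
move=> x y xy; have [x0|/ltW x0] := leP 0 x; first exact: mono.
rewrite (gamma0 x)//; have [y0|/ltW y0] := leP 0 y.
  by rewrite -(gamma0 0)//; exact: mono.
by rewrite gamma0.
Qed.

Let weight (t : R) := expR (gamma beta t / (p - 1)).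

Let weight_nondecreasing : {homo weight : x y / x <= y}.
Proof.
move=> x y xy; rewrite /weight ler_expR ler_pM2r ?invr_gt0 ?subr_gt0//.
exact: gamma_nondecreasing.
Qed.

Lemma Psi0 : Psi p beta 0 = 0.
Proof. by rewrite /Psi set_itv1 Rintegral_set1. Qed.

(** The integrand of [Psi] is at least [1]. This gives both the injectivity of
    [Psi] and its divergence at infinity. *)
Lemma Psi_increment_ge (a b : R) : 0 <= a -> a <= b ->
  b - a <= Psi p beta b - Psi p beta a.
Proof.
move=> a0 ab.
have /andP[+ _] :=
  nondecreasing_integral_increment _ _ _ _ weight_nondecreasing a0 ab.
apply: le_trans; rewrite -[leLHS]mul1r ler_wpM2r ?subr_ge0//.
rewrite /weight -[leLHS]expR0 ler_expR divr_ge0 ?subr_ge0 ?(ltW hp)//.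
by rewrite -(gamma0 0)// gamma_nondecreasing.
Qed.

Lemma Psi_invK (t : R) : 0 <= t -> Psi_inv p beta (Psi p beta t) = t.
Proof.
move=> t0; apply: pinvKV; last by rewrite inE/= in_itv/= t0.
move=> x y; rewrite !inE/= !in_itv/= !andbT => x0 y0 xy.
case: (leP x y) => [le_xy|/ltW le_yx].
  by have := Psi_increment_ge _ _ x0 le_xy; lra.
by have := Psi_increment_ge _ _ y0 le_yx; lra.
Qed.

(** The effect of a jump of [beta] during the time [d] that follows [s].  The
    window has length [2 * d]: in its second half [beta] has reached the height
    [M], which contributes [M * d] to [gamma].  In the bound of [Psi] the height
    enters through [2 * d * b'], which stays bounded when [M * d] is fixed, so
    that the factor [2 * d] in front of the exponential makes the last term as
    small as desired. *)
Lemma gamma_Psi_after_jump (s d b b' M : R) :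
  0 <= s -> 0 <= d -> beta s <= b -> beta (s + 2 * d) <= b' ->
  M <= beta (s + d) ->
  M * d <= gamma beta (s + 2 * d) /\
  Psi p beta (s + 2 * d) <= s * expR (s * b / (p - 1)) +
    2 * d * expR ((s * b + 2 * d * b') / (p - 1)).
Proof.
move=> s0 d0 sb sdb' sdM.
have [s1 s2 s3] : [/\ 0 <= s + d, s + d <= s + 2 * d & s <= s + 2 * d].
  by split; lra.
have q0 : 0 < (p - 1)^-1 by rewrite invr_gt0 subr_gt0.
have gamma_s : gamma beta s <= s * b.
  have /andP[_] := nondecreasing_integral_increment _ _ _ _ hbeta (lexx 0) s0.
  rewrite -/(gamma beta 0) gamma0// !subr0 => /le_trans; apply.
  by rewrite mulrC ler_wpM2l.
have gamma_sd : gamma beta (s + 2 * d) <= s * b + 2 * d * b'.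
  have /andP[_] := nondecreasing_integral_increment _ _ _ _ hbeta s0 s3.
  rewrite -/(gamma beta s) -/(gamma beta (s + 2 * d)) => h.
  have : beta (s + 2 * d) * (s + 2 * d - s) <= 2 * d * b'.
    by rewrite addrAC subrr add0r mulrC ler_wpM2l// mulr_ge0.
  lra.
split.
  have /andP[h _] := nondecreasing_integral_increment _ _ _ _ hbeta s1 s2.
  have : M * d <= beta (s + d) * (s + 2 * d - (s + d)).
    have -> : s + 2 * d - (s + d) = d by lra.
    by rewrite ler_wpM2r.
  have := gamma_nondecreasing _ _ s1; rewrite gamma0//.
  move: h; rewrite -/(gamma beta (s + d)) -/(gamma beta (s + 2 * d)); lra.
have Psi_s : Psi p beta s <= s * expR (s * b / (p - 1)).
  have /andP[_] :=
    nondecreasing_integral_increment _ _ _ _ weight_nondecreasing (lexx 0) s0.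
  rewrite -/(Psi p beta 0) Psi0 !subr0 => /le_trans; apply.
  by rewrite mulrC ler_wpM2l// ler_expR ler_pM2r.
have /andP[_] :=
  nondecreasing_integral_increment _ _ _ _ weight_nondecreasing s0 s3.
rewrite -/(Psi p beta s) -/(Psi p beta (s + 2 * d)) => h.
have : weight (s + 2 * d) * (s + 2 * d - s) <=
    2 * d * expR ((s * b + 2 * d * b') / (p - 1)).
  rewrite addrAC subrr add0r mulrC ler_wpM2l ?mulr_ge0//.
  by rewrite ler_expR ler_pM2r.
lra.
Qed.

End Primitives.

(** * Increasing functions with prescribed steep jumps *)

Definition ramp {R : realType} (d x : R) : R := Num.max 0 (Num.min 1 (x / d)).

(** The ramp that starts at [k] vanishes up to [k], so cutting the series at any
    integer beyond [t] does not change it; [Num.bound t] is one such integer. *)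
Definition staircase {R : realType} (M d : nat -> R) (t : R) : R :=
  t + \sum_(k < Num.bound t) M k * ramp (d k) (t - k%:R).

Section Staircase.
Context {R : realType}.
Variables (M d : nat -> R).
Hypotheses (M_ge0 : forall k, 0 <= M k) (d_gt0 : forall k, 0 < d k).

Lemma ramp_ge0 (e x : R) : 0 <= ramp e x.
Proof. by rewrite le_max lexx. Qed.

Lemma ramp_le1 (e x : R) : ramp e x <= 1.
Proof. by rewrite ge_max ler01 ge_min lexx. Qed.

Lemma ramp_eq0 (e x : R) : 0 < e -> x <= 0 -> ramp e x = 0.
Proof.
move=> e0 x0; apply: max_l; rewrite ge_min; apply/orP; right.
by rewrite pmulr_lle0 ?invr_gt0.
Qed.

Lemma ramp_eq1 (e x : R) : 0 < e -> e <= x -> ramp e x = 1.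
Proof.
by move=> e0 ex; rewrite /ramp min_l ?max_r// ler_pdivlMr// mul1r.
Qed.

Lemma ramp_nondecreasing (e : R) : 0 < e -> {homo ramp e : x y / x <= y}.
Proof.
move=> e0 x y xy; rewrite /ramp ge_max !le_max lexx/=; apply/orP; right.
by rewrite le_min !ge_min lexx/= ler_pM2r ?invr_gt0// xy orbT.
Qed.

Lemma ramp_continuous (e : R) : continuous (ramp e).
Proof.
move=> x.
have : {for x, continuous ((cst 0 : R -> R^o) \max
                           ((cst 1 : R -> R^o) \min (fun y : R => y / e)))}.
  apply: continuous_max; first exact: cst_continuous.
  apply: continuous_min; first exact: cst_continuous.
  exact: mulrr_continuous.
exact.
Qed.

(** A cut that is uniform in [t] on a half-line: this is what allows comparing
    two points, and proving continuity, with one and the same finite sum. *)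
Lemma staircaseE (n : nat) (t : R) : t <= n%:R ->
  staircase M d t = t + \sum_(k < n) M k * ramp (d k) (t - k%:R).
Proof.
have extend (m l : nat) : t <= m%:R -> (m <= l)%N ->
    \sum_(k < l) M k * ramp (d k) (t - k%:R) =
    \sum_(k < m) M k * ramp (d k) (t - k%:R).
  move=> tm ml.
  rewrite -(big_mkord xpredT (fun k => M k * ramp (d k) (t - k%:R))).
  rewrite (big_cat_nat (leq0n m) ml)//= big_mkord [X in _ + X]big1_seq ?addr0// => k.
  rewrite mem_index_iota => /andP[_ /andP[mk _]]; rewrite ramp_eq0 ?mulr0//.
  by rewrite subr_le0 (le_trans tm)// ler_nat.
have tb : t <= (Num.bound t)%:R.
  apply: (le_trans (ler_norm _)); apply/ltW.
  by have := archi_boundP (normr_ge0 t); rewrite /Num.bound normr_id.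
move=> tn; congr (_ + _); case: (leqP n (Num.bound t)) => [|/ltnW] h.
  exact: extend.
by symmetry; exact: extend.
Qed.

Lemma staircase_continuous : continuous (staircase M d).
Proof.
move=> t; have [n tn] : exists n : nat, t < n%:R.
  exists (Num.bound `|t|); apply: (le_lt_trans (ler_norm _)).
  exact: archi_boundP.
have near_eq : \forall x \near t,
    x + \sum_(k < n) M k * ramp (d k) (x - k%:R) = staircase M d x.
  by near do (rewrite -staircaseE//; apply/ltW); exact: lt_nbhsl.
rewrite /continuous_at -(nbhs_singleton near_eq).
apply: cvg_trans (near_eq_cvg near_eq) _.
apply: cvgD; first exact: cvg_id.
apply: cvg_big => [|k _]; first exact: add_continuous.
apply: cvgM; first exact: cvg_cst.
apply: (@continuous_cvg _ _ _ _ _ (fun x : R => x - k%:R) (ramp (d k))).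
  exact: ramp_continuous.
by apply: cvgB; [exact: cvg_id | exact: cvg_cst].
Unshelve. all: by end_near. Qed.

Lemma staircase_increasing : {homo staircase M d : x y / x < y}.
Proof.
move=> x y xy; have [n yn] : exists n : nat, y <= n%:R.
  exists (Num.bound `|y|); apply: (le_trans (ler_norm _)).
  by apply/ltW; exact: archi_boundP.
rewrite !(staircaseE n)// ?(le_trans (ltW xy))//; apply: ltr_leD => //.
apply: ler_sum => k _; rewrite ler_wpM2l// ramp_nondecreasing//.
by rewrite lerD2r ltW.
Qed.

Lemma staircase_ge (t : R) : t <= staircase M d t.
Proof.
by rewrite /staircase lerDl sumr_ge0// => k _; rewrite mulr_ge0// ramp_ge0.
Qed.

Lemma staircase_le (n : nat) (t : R) : t <= n%:R ->
  staircase M d t <= n%:R + \sum_(k < n) M k.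
Proof.
move=> tn; rewrite (staircaseE n)// lerD//; apply: ler_sum => k _.
by rewrite -[leRHS]mulr1 ler_wpM2l// ramp_le1.
Qed.

Lemma staircase_after_jump (n : nat) (t : R) : n%:R + d n <= t ->
  M n <= staircase M d t.
Proof.
move=> nt; have [m tm] : exists m : nat, t < m%:R.
  exists (Num.bound `|t|); apply: (le_lt_trans (ler_norm _)).
  exact: archi_boundP.
have nt' : n%:R < t by have := d_gt0 n; lra.
have nm : (n < m)%N by rewrite -(ltr_nat R) (lt_trans nt').
rewrite (staircaseE m _ (ltW tm)) (bigD1 (Ordinal nm))//=.
rewrite ramp_eq1 ?mulr1//; last by lra.
have t0 : 0 <= t by apply: ltW; apply: le_lt_trans nt'.
rewrite addrCA lerDl addr_ge0// sumr_ge0// => k _.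
by rewrite mulr_ge0// ramp_ge0.
Qed.

End Staircase.

(** * Choice of the jumps *)

(** Here [b] bounds the staircase up to time [n], hence
    [n * exp (n * b / q)] bounds [Psi n], and [b + 1 + M] bounds the staircase
    up to time [n + 1].  The area [M * d] is fixed first, by the required
    growth; the width [d] comes second and the height is the quotient. *)
Lemma exists_jump (R : realType) (q : R) (C : R -> R) (n : nat) (b : R) :
  0 < q -> (forall x, 0 <= C x) ->
  exists Md : R * R, [/\ 0 <= Md.1, 0 < Md.2, 2 * Md.2 <= 1,
    n%:R * C (n%:R * expR (n%:R * b / q) + 1) <= expR (Md.1 * Md.2 / q) - 1 &
    2 * Md.2 * expR ((n%:R * b + 2 * Md.2 * (b + 1 + Md.1)) / q) <= 1].
Proof.
move=> q0 C0; set c0 := n%:R * _.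
have c00 : 0 <= c0 by rewrite mulr_ge0.
(* The area under the jump, chosen such that expR (c / q) - 1 = c0. *)
pose c := q * ln (1 + c0).
have c_ge0 : 0 <= c by rewrite mulr_ge0 ?ln_ge0 ?lerDl// ltW.
(* A bound of gamma at the end of the window that holds for all widths e / 2
   with e <= 1; the width is then taken to be expR (- `|A| / q) / 2. *)
pose A := n%:R * b + `|b| + 1 + 2 * c.
pose e := expR (- (`|A| / q)).
have e0 : 0 < e := expR_gt0 _.
have e1 : e <= 1.
  by rewrite /e -expR0 ler_expR oppr_le0 divr_ge0// ltW.
have d0 : 0 < e / 2 by rewrite divr_gt0.
have d2 : 2 * (e / 2) = e by lra.
exists (c / (e / 2), e / 2); rewrite /= d2; split => //.
- by rewrite divr_ge0// ltW.
- rewrite divfK ?gt_eqF// /c [q * _]mulrC mulfK ?gt_eqF// lnK ?posrE; lra.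
have -> : e * (b + 1 + c / (e / 2)) = e * b + e + 2 * c.
  have : c / (e / 2) * (e / 2) = c by rewrite divfK ?gt_eqF.
  by set y := c / _; nra.
rewrite {1}/e -expRD -[leRHS]expR0 ler_expR -mulNr -mulrDl.
rewrite pmulr_lle0 ?invr_gt0//.
have : e * b <= `|b|.
  apply: (le_trans (ler_norm _)); rewrite normrM (gtr0_norm e0).
  by rewrite -[leRHS]mul1r ler_wpM2r.
by have := ler_norm A; rewrite /A; lra.
Qed.

(** [B n] bounds [staircase M d] on the times up to [n], see [staircase_le]. *)
Lemma exists_jumps (R : realType) (q : R) (C : R -> R) :
  0 < q -> (forall x, 0 <= C x) ->
  exists M d : nat -> R, let B n := n%:R + \sum_(k < n) M k in
  forall n, [/\ 0 <= M n, 0 < d n, 2 * d n <= 1,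
    n%:R * C (n%:R * expR (n%:R * B n / q) + 1) <= expR (M n * d n / q) - 1 &
    2 * d n * expR ((n%:R * B n + 2 * d n * B n.+1) / q) <= 1].
Proof.
move=> q0 C0.
have [f fP] := choice (fun nb : nat * R => exists_jump R q C nb.1 nb.2 q0 C0).
(* B is built first, as the state of the recursion; it is identified with
   the partial sums of M afterwards. *)
pose B := nat_rect (fun=> R) 0 (fun n b => b + 1 + (f (n, b)).1).
pose M n := (f (n, B n)).1.
have BE n : n%:R + \sum_(k < n) M k = B n.
  elim: n => [|n IH]; first by rewrite big_ord0 addr0.
  by rewrite big_ord_recr/= -natr1 addrACA IH addrA.
exists M, (fun n => (f (n, B n)).2) => /= n; rewrite !BE.
exact: fP (n, B n).
Qed.

(** * Convexity and upper limits *)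

(** Absolute values give one bound that covers the interior and both ends of
    the interval, and that is nonnegative as [exists_jumps] requires. *)
Lemma strictly_convex_le_ends (R : realType) (F : R -> R) (T x : R) :
  strictly_convex_on `[0, +oo[ F -> 0 <= x <= T -> F x <= `|F 0| + `|F T|.
Proof.
move=> hF /andP[x0 xT].
have l0 := ler_norm (F 0); have lT := ler_norm (F T).
have n0 := normr_ge0 (F 0); have nT := normr_ge0 (F T).
move: x0; rewrite le_eqVlt => /predU1P[<-|x0]; first by lra.
move: xT; rewrite le_eqVlt => /predU1P[->|xT]; first by lra.
have T0 : 0 < T := lt_trans x0 xT.
have xT1 : 0 < x / T < 1 by rewrite divr_gt0//= ltr_pdivrMr// mul1r.
have := hF T 0 (x / T); rewrite /= !in_itv/= !andbT ltW// lexx gt_eqF//.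
move=> /(_ isT isT isT xT1); rewrite mulr0 addr0 divfK ?gt_eqF//.
by move: xT1 => /andP[]; set s := x / T; nra.
Qed.

Lemma limf_esup_pinftyP (R : realType) (f : R -> R) :
  (forall A k : R, exists2 x, A < x & k <= f x) ->
  limf_esup (EFin \o f) +oo = +oo%E.
Proof.
move=> H; apply/eqP; rewrite eq_le leey/= limf_esupE.
apply: le_ereal_inf_tmp => _ [V [A [_ AV]] <-].
rewrite leye_eq; apply/eqP/eq_infty => k.
have [x Ax kx] := H A k.
by apply: ereal_sup_ge; exists (f x)%:E; [exists x => //; exact: AV | rewrite lee_fin].
Qed.

(** * Growth of g against a convex function *)

Theorem lemma7p7 (R : realType) (p : R) (F : R -> R)
    (hp : 1 < p)
    (hFcont : {within `[0, +oo[, continuous F})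
    (hFconv : strictly_convex_on `[0, +oo[ F)
    (hFlim : F s @[s --> +oo] --> +oo) :
  exists beta : R -> R,
    [/\ {within `[0, +oo[, continuous beta},
        {in `[0, +oo[ &, {homo beta : x y / x < y}},
        0 <= beta 0,
        beta t @[t --> +oo] --> +oo &
        limf_esup (fun tau : R => (g_of p beta tau / F tau)%:E) +oo = +oo%E].
Proof.
have q0 : 0 < p - 1 by rewrite subr_gt0.
have C0 x : 0 <= `|F 0| + `|F x| by rewrite addr_ge0.
have [M [d Md]] := exists_jumps R (p - 1) (fun x => `|F 0| + `|F x|) q0 C0.
have M0 n : 0 <= M n by case: (Md n).
have d0 n : 0 < d n by case: (Md n).
set beta := staircase M d.
have beta_incr : {homo beta : x y / x < y} by exact: staircase_increasing.
have beta_nd : {homo beta : x y / x <= y} by exact: ltW_homo.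
have beta0 : 0 <= beta 0 by exact: staircase_ge.
exists beta; split => //.
- by apply: continuous_subspaceT; exact: staircase_continuous.
- by move=> x y _ _; exact: beta_incr.
- apply: ger_cvgy; last exact: cvg_id.
  by near=> t; exact: staircase_ge.
apply: limf_esup_pinftyP => A k.
have [A0 [_ FA0]] := (cvgryPgt _).1 hFlim 0.
(* Psi t_n >= n, so this n puts Psi t_n beyond A and in the range where F is
   positive, which turns n * F <= g into k <= g / F. *)
have [n] : exists n : nat, [/\ A < n%:R, A0 < n%:R & k <= n%:R].
  pose m := `|A| + `|A0| + `|k|.
  have : m < (Num.bound m)%:R by apply: archi_boundP; rewrite !addr_ge0.
  have := ler_norm A; have := ler_norm A0; have := ler_norm k.
  have := normr_ge0 A; have := normr_ge0 A0; have := normr_ge0 k.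
  rewrite /m => *; exists (Num.bound m); split; rewrite /m; lra.
move=> [An A0n kn].
have [_ _ d1 Cn dn] := Md n.
set t := n%:R + 2 * d n.
have t_ge : n%:R <= t by have := d0 n; rewrite /t; lra.
have t0 : 0 <= t by exact: le_trans t_ge.
have tn1 : t <= n.+1%:R by rewrite -natr1 /t; lra.
have n0 : 0 <= n%:R :> R by [].
have [gamma_t Psi_t] := gamma_Psi_after_jump p beta hp beta_nd beta0 _ _ _ _ _
  n0 (ltW (d0 n)) (staircase_le M d M0 d0 n _ (lexx _))
  (staircase_le M d M0 d0 _ _ tn1) (staircase_after_jump M d M0 d0 n _ (lexx _)).
have Psi_ge : t <= Psi p beta t.
  have := Psi_increment_ge p beta hp beta_nd beta0 _ _ (lexx 0) t0.
  by rewrite Psi0 !subr0.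
exists (Psi p beta t); first by lra.
rewrite /g_of Psi_invK//.
have F_gt0 : 0 < F (Psi p beta t) by apply: FA0; lra.
rewrite ler_pdivlMr//; apply: (@le_trans _ _ (n%:R * F (Psi p beta t))).
  by rewrite ler_wpM2r// ltW.
apply: le_trans (le_trans Cn _); last first.
  by rewrite lerD2r ler_expR ler_pM2r ?invr_gt0.
rewrite ler_wpM2l// strictly_convex_le_ends//; apply/andP; split; first by lra.
by apply: (le_trans Psi_t); rewrite lerD2l.
Unshelve. all: by end_near. Qed.
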